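(* Let $A\in\mathbb{R}^{m\times n}$, $b\in\mathbb{R}^m$, and let $(\Omega,\mathcal F,P)$ and $(\overline\Omega,\overline{\mathcal F},\overline P)$ be probability spaces of sampling matrices $S$ and $T$, respectively. Let $$M=\mathbb E_{S\in\Omega}[SS^\top],\qquad \overline M=\mathbb E_{T\in\overline\Omega}[TT^\top],$$ $$\mathcal S=\left\{y\in\mathbb R^m \;\middle|\; M^{\frac12}y\in M^{\frac12}\left(b+\mathrm{Range}(A)\right),\ y\in\mathrm{Null}(A\overline M A^\top)\right\}.$$ Then $\mathcal X_\Phi=\mathcal X_{\mathrm{aug}}$ if and only if $\mathcal S=\{b_{\mathrm{Range}(A)^\perp}\}$ and $\mathrm{Null}(A^\top M A)=\mathrm{Null}(A)$.
   Context: Elements $S\in\Omega$ are real matrices with $m$ rows and elements $T\in\overline\Omega$ are real matrices with $n$ rows; the expectations $\mathbb E[SS^\top]$ and $\mathbb E[TT^\top]$ are assumed to exist and be finite. $b_{\mathrm{Range}(A)^\perp}$ denotes the orthogonal projection of $b$ onto the orthogonal complement $\mathrm{Range}(A)^\perp$ of the range space of $A$. $M^{1/2}$ is the positive semidefinite square root of $M$, and $M^{\frac12}(b+\mathrm{Range}(A))=\{M^{\frac12}v: v\in b+\mathrm{Range}(A)\}$. $\mathcal X_\Phi$ is the set of minimizers over $(x,z)\in\mathbb R^n\times\mathbb R^m$ of $$\Phi(x,z)=\mathbb E\left[\tfrac12\|T^\top A^\top z\|_2^2+\tfrac12\|S^\top(Ax-(b-z))\|_2^2\right].$$ $\mathcal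 X_{\mathrm{aug}}=\{(x,z)\in\mathbb R^n\times\mathbb R^m\mid A^\top z=0,\ Ax=b-z\}$ is the solution set of the augmented linear system. *)

(* Defs.v *)
From HB Require Import structures.
From mathcomp Require Import all_boot all_order all_algebra.
From mathcomp Require Import all_classical all_reals all_analysis.

Set Implicit Arguments.
Unset Strict Implicit.
Unset Printing Implicit Defensive.

Import Order.TTheory GRing.Theory Num.Theory.
Local Open Scope classical_set_scope.
Local Open Scope ring_scope.

(* The norm that MathComp-Analysis puts on matrices is the sup norm. *)
Definition norm2 (R : realType) (k : nat) (v : 'cV[R]_k) : R :=
  Num.sqrt (\sum_(i < k) v i 0 ^+ 2).

Definition dotp (R : realType) (k : nat) (u v : 'cV[R]_k) : R :=
  \sum_(i < k) u i 0 * v i 0.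

Definition Range (R : realType) (m n : nat) (A : 'M[R]_(m, n)) :
    set 'cV[R]_m :=
  [set A *m x | x in [set: 'cV[R]_n]].

Definition Null (R : realType) (m n : nat) (A : 'M[R]_(m, n)) :
    set 'cV[R]_n :=
  [set x | A *m x = 0].

Definition orthocomp (R : realType) (k : nat) (V : set 'cV[R]_k) :
    set 'cV[R]_k :=
  [set y | forall v, V v -> dotp y v = 0].

(* Meaningful when V is a linear subspace: then exactly one p satisfies the
   condition.  The default value 0 is never used in that case. *)
Definition orthoproj (R : realType) (k : nat) (V : set 'cV[R]_k)
    (b : 'cV[R]_k) : 'cV[R]_k :=
  xget 0 [set p | V p /\ orthocomp V (b - p)].

Definition psd (R : realType) (k : nat) (N : 'M[R]_k) : Prop :=
  N^T = N /\ forall v : 'cV[R]_k, 0 <= dotp v (N *m v).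

(* Meaningful when M is positive semidefinite: then exactly one N satisfies the
   condition.  The default value 0 is never used in that case. *)
Definition psdsqrt (R : realType) (k : nat) (M : 'M[R]_k) : 'M[R]_k :=
  xget 0 [set N | psd N /\ N *m N = M].

(* Random matrices with k rows are functions on a probability space; the number
   of columns q w may depend on the outcome w.  A sample space that is itself a set
   of matrices is the case in which S is the inclusion map. *)
Definition gram (R : realType) (T : Type) (k : nat) (q : T -> nat)
    (S : forall w, 'M[R]_(k, q w)) (w : T) : 'M[R]_k :=
  S w *m (S w)^T.

(* The expectation of the Gram matrix exists and is finite; integrability
   includes measurability of the entries of S S^T. *)
Definition gram_integrable (d : measure_display) (T : measurableType d)
    (R : realType) (P : probability T R) (k : nat) (q : T -> nat)
    (S : forall w, 'M[R]_(k, q w)) : Prop :=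
  forall i j, P.-integrable setT (fun w => (gram S w i j)%:E).

Definition mean_gram (d : measure_display) (T : measurableType d)
    (R : realType) (P : probability T R) (k : nat) (q : T -> nat)
    (S : forall w, 'M[R]_(k, q w)) : 'M[R]_k :=
  \matrix_(i, j) fine 'E_P[fun w => gram S w i j]%E.

(* S and T live on separate probability spaces; the expectation is taken over
   the product space, i.e., S and T are drawn independently. *)
Definition Phi (d1 d2 : measure_display) (Omega1 : measurableType d1)
    (Omega2 : measurableType d2) (R : realType)
    (P1 : probability Omega1 R) (P2 : probability Omega2 R) (m n : nat)
    (q1 : Omega1 -> nat) (q2 : Omega2 -> nat)
    (S : forall w, 'M[R]_(m, q1 w)) (T : forall w, 'M[R]_(n, q2 w))
    (A : 'M[R]_(m, n)) (b : 'cV[R]_m) (x : 'cV[R]_n) (z : 'cV[R]_m) : \bar R :=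
  'E_((P1 \x P2)%E)[fun w : Omega1 * Omega2 =>
     (2^-1 * norm2 ((T w.2)^T *m (A^T *m z)) ^+ 2
     + 2^-1 * norm2 ((S w.1)^T *m (A *m x - (b - z))) ^+ 2)%R]%E.

Definition XPhi (d1 d2 : measure_display) (Omega1 : measurableType d1)
    (Omega2 : measurableType d2) (R : realType)
    (P1 : probability Omega1 R) (P2 : probability Omega2 R) (m n : nat)
    (q1 : Omega1 -> nat) (q2 : Omega2 -> nat)
    (S : forall w, 'M[R]_(m, q1 w)) (T : forall w, 'M[R]_(n, q2 w))
    (A : 'M[R]_(m, n)) (b : 'cV[R]_m) : set ('cV[R]_n * 'cV[R]_m) :=
  [set p | forall x z,
     (Phi P1 P2 S T A b p.1 p.2 <= Phi P1 P2 S T A b x z)%E].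

Definition Xaug (R : realType) (m n : nat) (A : 'M[R]_(m, n)) (b : 'cV[R]_m) :
    set ('cV[R]_n * 'cV[R]_m) :=
  [set p | A^T *m p.2 = 0 /\ A *m p.1 = b - p.2].

Definition calS (R : realType) (m n : nat) (A : 'M[R]_(m, n)) (b : 'cV[R]_m)
    (M : 'M[R]_m) (Mbar : 'M[R]_n) : set 'cV[R]_m :=
  [set y | [set psdsqrt M *m v | v in [set b + u | u in Range A]]
             (psdsqrt M *m y)
           /\ Null (A *m Mbar *m A^T) y].

(* Main.v *)
Require Import Defs.
From HB Require Import structures.
From mathcomp Require Import all_boot all_order all_algebra.
From mathcomp Require Import all_classical all_reals all_analysis.
From mathcomp Require complex.
From mathcomp Require Import measurable_realfun sesquilinear spectral.

Set Implicit Arguments.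
Unset Strict Implicit.
Unset Printing Implicit Defensive.

Import Order.TTheory GRing.Theory Num.Theory.
Local Open Scope classical_set_scope.
Local Open Scope ring_scope.

(** The statement is linear algebra once the objective is computed.  Since S and T
    are drawn independently, Phi splits (PhiE) as
      Phi(x, z) = 1/2 <u, Mbar u> + 1/2 <r, M r>,  u = A^T z,  r = A x - (b - z),
    and both means of Gram matrices are positive semidefinite.

    For a positive semidefinite N, <v, N v> = |N^(1/2) v|^2, so <v, N v> = 0,
    N v = 0 and N^(1/2) v = 0 all say the same.  Hence Phi(x, z) = 0 exactly when
    A Mbar A^T z = 0 and M r = 0 (Phi_eq0).  The normal equations always have a
    solution, so the augmented system is consistent; Phi vanishes on it, and the
    minimizers of Phi are its zeros (XPhiE).

    Two remarks finish the proof.  The set calS is the projection of the set of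
    minimizers to the z coordinate (calSE), while every solution of the augmented
    system has z equal to p, the projection of b to the complement of the range.
    Given z = p and a fixed x0 with A x0 = b - p, the pair (x, p) minimizes Phi
    iff M A (x - x0) = 0, i.e. iff x - x0 lies in Null (A^T M A), and solves the
    augmented system iff x - x0 lies in Null A.  So the two solution sets agree
    iff the z parts agree and the two null spaces agree.

    The remaining ingredient is the existence of the square root of a real
    positive semidefinite matrix M (psd_sqrt_exists): over the complex numbers M is
    unitarily diagonalizable with real eigenvalues, so a real polynomial vanishing
    at the eigenvalues kills M (symmetric_annihilator).  If q is a real polynomial
    that interpolates the fourth root at the eigenvalues, then q(M)^2 is positive
    semidefinite, being the square of a symmetric matrix, and q(M)^4 = M. *)

(** * Annihilating polynomials of real symmetric matrices *)

Lemma poly_interpolation (F : fieldType) (f : F -> F) (s : seq F) :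
  exists q : {poly F}, {in s, forall c, q.[c] = f c}.
Proof.
elim: s => [|a s [q qs]]; first by exists 0.
case: (boolP (a \in s)) => as_.
  by exists q => c; rewrite inE => /predU1P[->|]; exact: qs.
pose w := \prod_(c <- s) ('X - c%:P).
have wa : w.[a] != 0 by rewrite -[_ == _]/(root w a) root_prod_XsubC.
exists (q + ((f a - q.[a]) / w.[a])%:P * w) => c.
rewrite !hornerE; case: (boolP (c \in s)) => [cs _|cs].
  have /rootP -> : root w c by rewrite root_prod_XsubC.
  by rewrite mulr0 addr0 qs.
rewrite inE (negbTE cs) orbF => /eqP ->.
by rewrite divfK // addrC subrK.
Qed.

Section SymmetricAnnihilator.
Import complex.

(** Working with polynomials in M keeps the square root real: the spectral theorem
    is applied over the complex numbers, but only the annihilation of M by real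
    polynomials is extracted from it. *)
Lemma symmetric_annihilator (R : rcfType) (k : nat) (M : 'M[R]_k.+1) :
  M^T = M -> exists2 s : seq R, {in s, forall c, eigenvalue M c} &
    forall p : {poly R}, {in s, forall c, p.[c] = 0} -> horner_mx M p = 0.
Proof.
move=> symM; pose C : numClosedFieldType := complex R.
pose toC : {rmorphism R -> C} := real_complex R.
pose MC := map_mx toC M.
have hermMC : MC \is hermsymmx.
  apply: realsym_hermsym.
    apply/is_hermitianmxP; rewrite expr0 scale1r map_mx_id //.
    by rewrite /MC map_trmx symM.
  by apply/mxOverP => i j; rewrite mxE complex_real.
have /orthomx_spectralP MCE := hermitian_normalmx hermMC.
have dreal := hermitian_spectral_diag_real hermMC.
set P := spectralmx MC in MCE; set d := spectral_diag MC in MCE dreal.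
have Punit : P \in unitmx := spectral_unit MC.
pose e i := complex.Re (d 0 i).
have dE i : d 0 i = toC (e i).
  by have /mxOverP/(_ 0 i) := dreal; move/RRe_real.
exists [seq e i | i <- enum 'I_k.+1] => [c /mapP[i _ ->]|p ps].
  (* The characteristic polynomial of MC is that of M with coefficients embedded,
     so a real eigenvalue of MC is already an eigenvalue of M. *)
  rewrite eigenvalue_root_char -(fmorph_root toC) map_char_poly.
  rewrite -eigenvalue_root_char -dE; apply/eigenvalueP; exists (row i P).
    rewrite -row_mul -/MC {1}MCE !mulmxA mulmxV // mul1mx.
    by rewrite row_mul row_diag_mx -scalemxAl -rowE.
  rewrite rowE; apply/negP => /eqP /(congr1 (mulmx^~ (invmx P))).
  rewrite mulmxK // mul0mx => /matrixP/(_ 0 i)/eqP.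
  by rewrite !mxE !eqxx oner_eq0.
apply: (map_mx_inj (f := toC)); rewrite map_horner_mx map_mx0 -/MC MCE.
rewrite mxred.horner_mx_uconjC // horner_mx_diag.
suff -> : map_mx (horner (map_poly toC p)) d = 0.
  by rewrite raddf0 mulmx0 mul0mx.
apply/rowP => i; rewrite !mxE dE horner_map ps ?rmorph0 //.
by apply: map_f; rewrite mem_enum.
Qed.

End SymmetricAnnihilator.

(** * The Euclidean inner product *)

Section Dotp.
Variable R : realType.

Lemma dotpE k (u v : 'cV[R]_k) : dotp u v = (u^T *m v) 0 0.
Proof. by rewrite mxE; apply: eq_bigr => i _; rewrite mxE. Qed.

Lemma dotp_mulmxl k l (A : 'M[R]_(k, l)) u v :
  dotp (A *m u) v = dotp u (A^T *m v).
Proof. by rewrite !dotpE trmx_mul mulmxA. Qed.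

Lemma dotpC k (u v : 'cV[R]_k) : dotp u v = dotp v u.
Proof. by apply: eq_bigr => i _; exact: mulrC. Qed.

Lemma dotpDl k (u v w : 'cV[R]_k) : dotp (u + v) w = dotp u w + dotp v w.
Proof. by rewrite !dotpE linearD mulmxDl mxE. Qed.

Lemma dotp0l k (v : 'cV[R]_k) : dotp 0 v = 0.
Proof. by rewrite dotpE trmx0 mul0mx mxE. Qed.

Lemma dotp_ge0 k (v : 'cV[R]_k) : 0 <= dotp v v.
Proof. by apply: sumr_ge0 => i _; rewrite -expr2 sqr_ge0. Qed.

Lemma dotp_eq0 k (v : 'cV[R]_k) : dotp v v = 0 -> v = 0.
Proof.
move=> v0; apply/colP => i; rewrite [RHS]mxE.
have /psumr_eq0P := v0.
move/(_ (fun i _ => ltac:(by rewrite -expr2 sqr_ge0)))/(_ i isT)/eqP.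
by rewrite -expr2 sqrf_eq0 => /eqP.
Qed.

Lemma norm2_sqr k (v : 'cV[R]_k) : norm2 v ^+ 2 = dotp v v.
Proof.
rewrite sqr_sqrtr; last by apply: sumr_ge0 => i _; rewrite sqr_ge0.
by apply: eq_bigr => i _; rewrite expr2.
Qed.

End Dotp.

(** * Positive semidefinite matrices and their square roots *)

Section PositiveSemidefinite.
Variable R : realType.

Lemma psd_eigenvalue_ge0 k (M : 'M[R]_k) c :
  psd M -> eigenvalue M c -> 0 <= c.
Proof.
case=> symM posM /eigenvalueP[v vM v0].
have := posM v^T; rewrite -{1}symM -trmx_mul vM linearZ /= dotpE -scalemxAr.
rewrite mxE -dotpE pmulr_lge0 // lt_neqAle dotp_ge0 andbT eq_sym.
apply: contra v0 => /eqP/dotp_eq0/(congr1 trmx).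
by rewrite trmxK trmx0 => ->.
Qed.

Lemma psd_mulmx_sym k (Q : 'M[R]_k) : Q^T = Q -> psd (Q *m Q).
Proof.
move=> symQ; split=> [|v]; first by rewrite trmx_mul symQ.
by rewrite -mulmxA -{1}symQ -dotp_mulmxl dotp_ge0.
Qed.

Lemma horner_mx_sym k (M : 'M[R]_k.+1) p :
  M^T = M -> (horner_mx M p)^T = horner_mx M p.
Proof.
move=> symM; elim/poly_ind: p => [|p c ih]; first by rewrite rmorph0 trmx0.
rewrite rmorphD rmorphM /= horner_mx_X horner_mx_C linearD /= tr_scalar_mx.
congr (_ + _); rewrite -[_ * M]/(_ *m M) trmx_mul ih symM.
exact/comm_mx_horner.
Qed.

(** Interpolating the fourth root rather than the square root makes positivity
    immediate: the root N is itself the square of a symmetric matrix. *)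
Lemma psd_sqrt_exists k (M : 'M[R]_k) :
  psd M -> exists N, psd N /\ N *m N = M.
Proof.
case: k M => [|k] M psdM.
  by exists M; split=> //; rewrite [M]thinmx0 mulmx0.
have [symM _] := psdM.
have [s eig_s kill_s] := symmetric_annihilator symM.
have [q qs] := poly_interpolation (fun c => Num.sqrt (Num.sqrt c)) s.
exists (horner_mx M q *m horner_mx M q); split.
  exact/psd_mulmx_sym/horner_mx_sym.
have : horner_mx M (q * q * (q * q) - 'X) = 0.
  apply: kill_s => c cs; have c0 := psd_eigenvalue_ge0 psdM (eig_s c cs).
  rewrite hornerD hornerN hornerX !hornerM qs // -!expr2.
  by rewrite !sqr_sqrtr ?sqrtr_ge0 // subrr.
rewrite rmorphB /= horner_mx_X !rmorphM => /eqP.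
by rewrite subr_eq0 => /eqP.
Qed.

Lemma psdsqrtP k (M : 'M[R]_k) :
  psd M -> psd (psdsqrt M) /\ psdsqrt M *m psdsqrt M = M.
Proof. by move=> /psd_sqrt_exists; exact: xgetPex. Qed.

Lemma dotp_psdsqrt k (M : 'M[R]_k) (v : 'cV[R]_k) :
  psd M -> dotp v (M *m v) = dotp (psdsqrt M *m v) (psdsqrt M *m v).
Proof.
by case/psdsqrtP => -[sN _] N2; rewrite dotp_mulmxl sN mulmxA N2.
Qed.

Lemma psd_dotp_eq0 k (M : 'M[R]_k) (v : 'cV[R]_k) :
  psd M -> dotp v (M *m v) = 0 <-> psdsqrt M *m v = 0.
Proof.
move=> psdM; rewrite dotp_psdsqrt //; split=> [/dotp_eq0 //|->].
exact: dotp0l.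
Qed.

(** This lets the condition on M^(1/2) in the definition of calS be read as one on M. *)
Lemma psdsqrt_mulmx_eq0 k (M : 'M[R]_k) (v : 'cV[R]_k) :
  psd M -> M *m v = 0 <-> psdsqrt M *m v = 0.
Proof.
move=> psdM; split=> [Mv0|Nv0].
  by apply/(psd_dotp_eq0 v psdM); rewrite Mv0 dotpE mulmx0 mxE.
by have [_ <-] := psdsqrtP psdM; rewrite -mulmxA Nv0 mulmx0.
Qed.

End PositiveSemidefinite.

(** * Means of random Gram matrices *)

Section MeanGram.
Local Open Scope ereal_scope.
Context (R : realType) (d : measure_display) (Omega : measurableType d).
Context (P : probability Omega R) (k : nat) (q : Omega -> nat).
Variables (S : forall w, 'M[R]_(k, q w)) (intS : gram_integrable P S).

(** Only the entries of S S^T are assumed measurable and integrable, so the random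
    quadratic form is written as a linear combination of them. *)
Lemma norm2_gram v w :
  (norm2 ((S w)^T *m v) ^+ 2)%:E =
  \sum_i \sum_j ((v i 0 * v j 0)%R%:E * (gram S w i j)%:E).
Proof.
rewrite norm2_sqr dotp_mulmxl trmxK mulmxA -sumEFin; apply: eq_bigr => i _.
rewrite mxE mulr_sumr -sumEFin; apply: eq_bigr => j _.
by rewrite -EFinM mulrA mulrAC.
Qed.

Lemma integrable_norm2_gram v :
  P.-integrable setT (fun w => (norm2 ((S w)^T *m v) ^+ 2)%:E).
Proof.
under eq_fun do rewrite norm2_gram.
apply: integrable_sum => // i _; apply: integrable_sum => // j _.
exact/integrableZl/intS.
Qed.

Lemma integral_norm2_gram v :
  \int[P]_w (norm2 ((S w)^T *m v) ^+ 2)%:E = (dotp v (mean_gram P S *m v))%:E.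
Proof.
under eq_integral do rewrite norm2_gram.
rewrite integral_sum //; last first.
  move=> i; apply: integrable_sum => // j _; exact/integrableZl/intS.
rewrite -sumEFin; apply: eq_bigr => i _.
rewrite integral_sum //; last by move=> j; exact/integrableZl/intS.
rewrite mxE mulr_sumr -sumEFin; apply: eq_bigr => j _.
rewrite integralZl //.
rewrite mxE unlock mulrA mulrAC [RHS]EFinM fineK //.
by apply: integrable_fin_num => //; exact: intS.
Qed.

Lemma psd_mean_gram : psd (mean_gram P S).
Proof.
split=> [|v].
  apply/matrixP => i j; rewrite !mxE; congr (fine _); congr ('E_P[_]).
  apply/funext => w; suff /matrixP/(_ j i) : (gram S w)^T = gram S w by rewrite mxE.
  by rewrite trmx_mul trmxK.
rewrite -lee_fin -integral_norm2_gram; apply: integral_ge0 => w _.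
by rewrite lee_fin sqr_ge0.
Qed.

End MeanGram.

(** * The objective as a quadratic form *)

Lemma integral_prod_addition (R : realType) (d1 d2 : measure_display)
    (Omega1 : measurableType d1) (Omega2 : measurableType d2)
    (P1 : probability Omega1 R) (P2 : probability Omega2 R)
    (f1 : Omega1 -> R) (f2 : Omega2 -> R) :
  (forall w, 0 <= f1 w) -> (forall w, 0 <= f2 w) ->
  P1.-integrable setT (EFin \o f1) -> P2.-integrable setT (EFin \o f2) ->
  (\int[P1 \x P2]_w (f2 w.2 + f1 w.1)%:E
   = \int[P2]_w (f2 w)%:E + \int[P1]_w (f1 w)%:E)%E.
Proof.
move=> f1_ge0 f2_ge0 if1 if2.
have f2E : (\int[P2]_w (f2 w)%:E)%E = (fine (\int[P2]_w (f2 w)%:E)%E)%:E.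
  by rewrite fineK //; exact: integrable_fin_num.
rewrite fubini_tonelli1; first last.
- by move=> w; rewrite lee_fin addr_ge0.
- under eq_fun do rewrite EFinD; apply: emeasurable_funD.
    apply/measurable_EFinP; apply: (measurableT_comp (f := f2)) => //.
    exact/measurable_EFinP/(measurable_int P2).
  apply/measurable_EFinP; apply: (measurableT_comp (f := f1)) => //.
    exact/measurable_EFinP/(measurable_int P1).
rewrite f2E; set c2 := fine _.
transitivity (\int[P1]_w (c2%:E + (f1 w)%:E))%E.
  apply: eq_integral => w1 _; rewrite /fubini_F /=.
  under eq_integral do rewrite EFinD.
  rewrite integralD //; last exact: finite_measure_integrable_cst.
  by rewrite f2E integral_cst //= probability_setT mule1.
rewrite integralD //; last exact: finite_measure_integrable_cst.
by rewrite integral_cst //= probability_setT mule1.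
Qed.

Section Objective.
Context (R : realType) (m n : nat) (A : 'M[R]_(m, n)) (b : 'cV[R]_m).
Context (d1 d2 : measure_display).
Context (Omega1 : measurableType d1) (Omega2 : measurableType d2).
Context (P1 : probability Omega1 R) (P2 : probability Omega2 R).
Context (q1 : Omega1 -> nat) (q2 : Omega2 -> nat).
Variables (S : forall w, 'M[R]_(m, q1 w)) (T : forall w, 'M[R]_(n, q2 w)).
Hypotheses (intS : gram_integrable P1 S) (intT : gram_integrable P2 T).
Local Notation M := (mean_gram P1 S).
Local Notation Mbar := (mean_gram P2 T).

Lemma PhiE x z : Phi P1 P2 S T A b x z =
  (2^-1 * dotp (A^T *m z) (Mbar *m (A^T *m z))
   + 2^-1 * dotp (A *m x - (b - z)) (M *m (A *m x - (b - z))))%:E.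
Proof.
set u := A^T *m z; set r := A *m x - (b - z).
have half_ge0 t : 0 <= 2^-1 * t ^+ 2 :> R by rewrite mulr_ge0 ?invr_ge0 ?sqr_ge0.
have iT := integrable_norm2_gram intT u; have iS := integrable_norm2_gram intS r.
rewrite /Phi unlock.
rewrite (integral_prod_addition
  (f1 := fun w => 2^-1 * norm2 ((S w)^T *m r) ^+ 2)
  (f2 := fun w => 2^-1 * norm2 ((T w)^T *m u) ^+ 2)) //=; first last.
- exact: (integrableZl measurableT 2^-1 iT).
- exact: (integrableZl measurableT 2^-1 iS).
under eq_integral do rewrite EFinM.
under [X in (_ + X)%E]eq_integral do rewrite EFinM.
by rewrite !integralZl // !integral_norm2_gram // -!EFinM -EFinD.
Qed.

End Objective.

(** * Least squares and the augmented system *)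

Section LeastSquares.
Context (R : realType) (m n : nat) (A : 'M[R]_(m, n)) (b : 'cV[R]_m).

(** The matrices A^T A and A have the same row space: v A^T A = 0 implies
    |v A^T|^2 = v A^T A v^T = 0, so their ranks agree. *)
Lemma normal_equation : exists x, A^T *m (A *m x) = A^T *m b.
Proof.
have kerS : (kermx (A^T *m A) <= kermx A^T)%MS.
  apply/row_subP => i; set v := row i _.
  have : v *m (A^T *m A) = 0 by apply/sub_kermxP; exact: row_sub.
  move=> /(congr1 (fun w => (w *m v^T) 0 0)); rewrite mul0mx mxE [RHS]mxE => vv.
  apply/sub_kermxP/(@trmx_inj _ 1 m); rewrite trmx0; apply: dotp_eq0.
  by rewrite dotpE trmxK trmx_mul trmxK !mulmxA mxE -[RHS]vv !mulmxA.
have sub : (A^T *m A <= A)%MS by exact: submxMl.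
have : (A^T *m A == A)%MS.
  rewrite -(mxrank_leqif_eq sub) eqn_leq mxrankS //= -(mxrank_tr A).
  by have := mxrankS kerS; rewrite !mxrank_ker leq_sub2lE ?rank_leq_row.
case/andP => _ /submxP[D /(congr1 trmx)].
by rewrite !trmx_mul trmxK => AE; exists (D^T *m b); rewrite {2}AE !mulmxA.
Qed.

Lemma orthocomp_Range : orthocomp (Range A) = Null A^T.
Proof.
apply/seteqP; split=> y /= Ay.
  apply: dotp_eq0; rewrite dotp_mulmxl trmxK; apply: Ay.
  by exists (A^T *m y).
move=> _ [x _ <-].
by rewrite dotpC dotp_mulmxl Ay dotpC dotp0l.
Qed.

(** Solvability of the normal equations provides a vector p0 with the property that
    defines the projection, and the second orthogonality condition identifies the
    chosen vector with p0. *)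
Lemma orthoproj_orthocomp_Range (p := orthoproj (orthocomp (Range A)) b) :
  A^T *m p = 0 /\ exists x, A *m x = b - p.
Proof.
have [x0 Ax0] := normal_equation; pose p0 := b - A *m x0.
have Ap0 : A^T *m p0 = 0 by rewrite mulmxBr Ax0 subrr.
have perp v : A^T *m v = 0 -> dotp (A *m x0) v = 0.
  by move=> Av; rewrite dotp_mulmxl Av dotpC dotp0l.
have ex : exists y, [set y | orthocomp (Range A) y
    /\ orthocomp (orthocomp (Range A)) (b - y)] y.
  exists p0; rewrite /= orthocomp_Range; split=> // v /perp.
  by rewrite /p0 opprB addrC subrK.
have [] := xgetPex 0 ex; rewrite -/(orthoproj _ b) -/p orthocomp_Range => Ap perp_p.
suff -> : p = p0.
  by split=> //; exists x0; rewrite /p0 opprB addrC subrK.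
have Av : A^T *m (p0 - p) = 0 by rewrite mulmxBr Ap0 Ap subrr.
apply/esym/eqP; rewrite -subr_eq0; apply/eqP/dotp_eq0.
have := perp_p _ Av; have -> : b - p = A *m x0 + (p0 - p).
  by rewrite /p0 addrA [A *m x0 + _]addrC subrK.
by rewrite dotpDl perp // add0r.
Qed.

(** Two such z differ by a vector that is both in the range of A and orthogonal
    to it. *)
Lemma augmented_unique x1 z1 x2 z2 :
  Xaug A b (x1, z1) -> Xaug A b (x2, z2) -> z1 = z2.
Proof.
move=> [/= Az1 Ax1] [/= Az2 Ax2].
apply/eqP; rewrite -subr_eq0; apply/eqP/dotp_eq0.
have {1}-> : z1 - z2 = A *m (x2 - x1).
  by rewrite mulmxBr Ax1 Ax2 opprB [RHS]addrC addrA subrK.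
by rewrite dotp_mulmxl mulmxBr Az1 Az2 subrr dotpC dotp0l.
Qed.

End LeastSquares.

(** * The minimizers of the objective *)

Section Minimizers.
Context (R : realType) (m n : nat) (A : 'M[R]_(m, n)) (b : 'cV[R]_m).
Context (d1 d2 : measure_display).
Context (Omega1 : measurableType d1) (Omega2 : measurableType d2).
Context (P1 : probability Omega1 R) (P2 : probability Omega2 R).
Context (q1 : Omega1 -> nat) (q2 : Omega2 -> nat).
Variables (S : forall w, 'M[R]_(m, q1 w)) (T : forall w, 'M[R]_(n, q2 w)).
Hypotheses (intS : gram_integrable P1 S) (intT : gram_integrable P2 T).
Local Notation M := (mean_gram P1 S).
Local Notation Mbar := (mean_gram P2 T).

Lemma Phi_ge0 x z : (0 <= Phi P1 P2 S T A b x z)%E.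
Proof.
rewrite PhiE // lee_fin addr_ge0 // mulr_ge0 ?invr_ge0 //.
  by have [_] := psd_mean_gram intT; exact.
by have [_] := psd_mean_gram intS; exact.
Qed.

Lemma Phi_eq0 x z : Phi P1 P2 S T A b x z = 0%E <->
  Null (A *m Mbar *m A^T) z /\ M *m (A *m x - (b - z)) = 0.
Proof.
have psdM := psd_mean_gram intS; have psdN := psd_mean_gram intT.
set r := A *m x - (b - z).
rewrite PhiE // -/r; set u := A^T *m z.
have u_ge0 : 0 <= 2^-1 * dotp u (Mbar *m u).
  by rewrite mulr_ge0 ?invr_ge0 //; exact: psdN.2.
have r_ge0 : 0 <= 2^-1 * dotp r (M *m r).
  by rewrite mulr_ge0 ?invr_ge0 //; exact: psdM.2.
have uE : dotp u (Mbar *m u) = 0 <-> Null (A *m Mbar *m A^T) z.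
  rewrite /Null /= -!mulmxA -/u; split=> [|AMu].
    by rewrite psd_dotp_eq0 // -psdsqrt_mulmx_eq0 // => ->; rewrite mulmx0.
  by rewrite dotp_mulmxl trmxK AMu dotpC dotp0l.
rewrite -uE psdsqrt_mulmx_eq0 // -psd_dotp_eq0 //.
split=> [[/eqP]|[-> ->]]; last by rewrite mulr0 addr0.
rewrite paddr_eq0 // !mulf_eq0 invr_eq0 pnatr_eq0 /=.
by move=> /andP[/eqP ? /eqP ?].
Qed.

Lemma Xaug_sub_Phi0 x z : Xaug A b (x, z) -> Phi P1 P2 S T A b x z = 0%E.
Proof.
move=> [/= Az Ax]; apply/Phi_eq0; split.
  by rewrite /Null /= -mulmxA Az mulmx0.
by rewrite Ax subrr mulmx0.
Qed.

(** The augmented system is consistent and its solutions are zeros of the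
    nonnegative function Phi, so the minimum value is 0. *)
Lemma XPhiE x z : XPhi P1 P2 S T A b (x, z) <-> Phi P1 P2 S T A b x z = 0%E.
Proof.
split=> [minxz|Phi0 x' z' /=]; last by rewrite Phi0 Phi_ge0.
have [Ap [x0 Ax0]] := orthoproj_orthocomp_Range A b.
apply/eqP; rewrite eq_le Phi_ge0 andbT.
by rewrite -(Xaug_sub_Phi0 (conj Ap Ax0)); exact: minxz.
Qed.

(** Up to the sign of x, the membership of M^(1/2) z in M^(1/2) (b + Range A) is the
    condition M (A x - (b - z)) = 0 for some x. *)
Lemma calSE z : calS A b M Mbar z <-> exists x, XPhi P1 P2 S T A b (x, z).
Proof.
have psdM := psd_mean_gram intS.
have residual x : psdsqrt M *m (b + A *m x) = psdsqrt M *m z <->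
    M *m (A *m (- x) - (b - z)) = 0.
  rewrite psdsqrt_mulmx_eq0 //.
  have -> : A *m (- x) - (b - z) = z - (b + A *m x).
    by rewrite mulmxN opprB opprD addrCA [- (A *m x) - b]addrC.
  rewrite mulmxBr; split=> [->|/eqP]; first exact: subrr.
  by rewrite subr_eq0 => /eqP.
split=> [[[_ [_ [x _ <-] <-]] eqx zN]|[x /XPhiE/Phi_eq0[zN eqx]]].
  by exists (- x); apply/XPhiE/Phi_eq0; split=> //; exact/residual.
split=> //; exists (b + A *m (- x)); last by apply/residual; rewrite opprK.
by exists (A *m (- x)) => //; exists (- x).
Qed.

Lemma Null_gram_rangeE x : Null (A^T *m M *m A) x <-> M *m (A *m x) = 0.
Proof.
have psdM := psd_mean_gram intS; rewrite /Null /= -!mulmxA.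
split=> [MAx|->]; last exact: mulmx0.
apply/(psdsqrt_mulmx_eq0 _ psdM)/(psd_dotp_eq0 _ psdM).
by rewrite dotp_mulmxl MAx dotpC dotp0l.
Qed.

End Minimizers.

Theorem theorem2p2 (R : realType) (m n : nat)
    (A : 'M[R]_(m, n)) (b : 'cV[R]_m)
    (d1 d2 : measure_display)
    (Omega1 : measurableType d1) (Omega2 : measurableType d2)
    (P1 : probability Omega1 R) (P2 : probability Omega2 R)
    (q1 : Omega1 -> nat) (q2 : Omega2 -> nat)
    (S : forall w, 'M[R]_(m, q1 w)) (T : forall w, 'M[R]_(n, q2 w))
    (intS : gram_integrable P1 S) (intT : gram_integrable P2 T) :
  XPhi P1 P2 S T A b = Xaug A b <->
  calS A b (mean_gram P1 S) (mean_gram P2 T)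
    = [set orthoproj (orthocomp (Range A)) b]
  /\ Null (A^T *m mean_gram P1 S *m A) = Null A.
Proof.
set p := orthoproj _ b.
have [Ap [x0 Ax0]] := orthoproj_orthocomp_Range A b.
rewrite -/p in Ap Ax0.
have aug0 : Xaug A b (x0, p) by [].
split=> [XE|[calSE1 NullE]].
  split.
    apply/seteqP; split=> z /=.
      by rewrite calSE // => -[x]; rewrite XE => xz; exact: (augmented_unique xz aug0).
    by move=> ->; rewrite calSE //; exists x0; rewrite XE.
  apply/seteqP; split=> x /=; last first.
    by rewrite /Null /= -mulmxA => ->; rewrite mulmx0.
  move=> /(Null_gram_rangeE _ intS) MAx.
  have : Xaug A b (x0 + x, p).
    rewrite -XE; apply/XPhiE/Phi_eq0 => //; split.
      by rewrite /Null /= -mulmxA Ap mulmx0.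
    by rewrite [A *m (_ + _)]mulmxDr Ax0 [b - p + _]addrC addrK.
  case=> _ /=; rewrite mulmxDr Ax0 => /eqP.
  by rewrite addrC -subr_eq0 addrK => /eqP.
apply/seteqP; split=> -[x z] xz; last by apply/XPhiE/Xaug_sub_Phi0.
have zp : z = p.
  have : calS A b (mean_gram P1 S) (mean_gram P2 T) z.
    by apply/calSE => //; exists x.
  by rewrite calSE1.
move/XPhiE/Phi_eq0 : xz; rewrite zp -Ax0 -mulmxBr.
case=> // _ /(Null_gram_rangeE _ intS); rewrite NullE /Null /= mulmxBr Ax0.
by move=> /eqP; rewrite subr_eq0 => /eqP.
Qed.
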